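(* For $n\ge 0$ define $$P_n(x,y,z,w)=\sum_{\pi\in \mathrm{PF}(n)} x^{\mathrm{unl}(\pi)}y^{\mathrm{dis}(\pi)}z^{\mathrm{des}(\pi)}w^{\mathrm{rlm}(\pi)},\qquad Q_n(x,y,z,w)=\sum_{T} x^{\mathrm{nld}(T)}y^{\mathrm{inv}(T)}z^{\mathrm{lev}(T)-1}w^{\deg_T(0)},$$ where the second sum is over all trees $T$ on the vertex set $\{0,1,\dots,n\}$ rooted at $0$, and $P_0=Q_0=1$. Then for every $n\ge1$: (a) $$P_n(x,y,z,w)=(1+xy+\cdots+xy^{n-1})\,w\,P_{n-1}(x,y,z,1)+\sum_{i=0}^{n-2}\binom{n-1}{i}(1+xy+\cdots+xy^{i})\,z\,w\,P_i(x,y,z,1)\,P_{n-i-1}(x,y,z,w);$$ (b) $$Q_n(x,y,z,w)=(1+xy+\cdots+xy^{n-1})\,w\,Q_{n-1}(x,y,z,1)+\sum_{i=0}^{n-2}\binom{n-1}{i}(1+xy+\cdots+xy^{i})\,z\,w\,Q_i(x,y,z,1)\,Q_{n-i-1}(x,y,z,w).$$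
   Context: Classical parking: there are $n$ spots $1,\dots,n$ on a one-way street and cars $C_1,\dots,C_n$ with preferences $\pi=(a_1,\dots,a_n)\in[n]^n$; the cars arrive in order, car $C_i$ goes to spot $a_i$ and parks in the first unoccupied spot among $a_i,a_i+1,\dots$. $\pi$ is a parking function if all cars park; $\mathrm{PF}(n)$ is the set of parking functions of length $n$ (equivalently, the increasing rearrangement $b_1\le\dots\le b_n$ satisfies $b_i\le i$). The outcome $\mathrm{oc}(\pi)=b_1\cdots b_n\in\mathfrak S_n$ has $b_i$ the spot occupied by car $C_i$. $\mathrm{dis}(\pi)=\sum_i (b_i-a_i)$ (displacement); $\mathrm{unl}(\pi)$ is the number of cars not parking in their preferred spot; $\mathrm{des}(\pi)$ is the number of descents (indices $i\le n-1$ with $c_i>c_{i+1}$) of the permutation $\mathrm{oc}(\pi)^{-1}=c_1\cdots c_n$; $\mathrm{rlm}(\pi)$ is the number of right-to-left maxima (indices $i$ with $c_i>c_j$ for all $j>i$) of $\mathrm{oc}(\pi)^{-1}$. For a tree $T$ on $\{0,\dots,n\}$ rooted at $0$: an inversion is a pair $(i,j)$ of vertices with $i<j$ such that $j$ lies on the unique path from $0$ to $i$; $\mathrm{inv}(T)$ is their number. A leader is a non-root vertex which is the smallest vertex of the subtree rooted at it; $\mathrm{nld}(T)$ is the number of non-root vertices that are not leaders. A leaf is a vertex with no children (the root of the one-vertex tree counts as a leaf); $\mathrm{lev}(T)$ is the number of leaves. $\deg_T(0)$ is the number of children of $0$. *)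

(* Defs.v *)
From HB Require Import structures.
From mathcomp Require Import all_boot all_order all_fingroup all_algebra.

Set Implicit Arguments.
Unset Strict Implicit.
Unset Printing Implicit Defensive.

Import GRing.Theory.

(* Spots, cars and preferences are numbered from 0: 'I_n stands for {1..n}.
   None of the statistics below is affected by this shift. *)
Section Parking.

Variable n : nat.
Implicit Types (occ : {set 'I_n}) (a : 'I_n) (s : seq 'I_n).
Implicit Types (pi : n.-tuple 'I_n) (c : 'S_n).

(* [enum 'I_n] is increasing, so this is the first unoccupied spot among
   a, a+1, ... (None if there is none). *)
Definition first_free occ a : option 'I_n :=
  ohead [seq j : 'I_n <- enum 'I_n | (a <= j) && (j \notin occ)].

(* The spots taken by successive cars with preferences s, when the spots in occ
   are already occupied; None marks a car which fails to park. *)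
Fixpoint park occ s : seq (option 'I_n) :=
  if s is a :: s' then
    if first_free occ a is Some j then Some j :: park (j |: occ) s'
    else None :: park occ s'
  else [::].

Definition parking_function pi : bool := all isSome (park set0 pi).

Definition PF : {set n.-tuple 'I_n} := [set pi | parking_function pi].

Definition spot pi (i : 'I_n) : option 'I_n := nth None (park set0 pi) i.

(* The default values are irrelevant for parking functions, see [ocE]. *)
Definition oc pi : 'S_n :=
  insubd (1%g : 'S_n) [ffun i => odflt (tnth pi i) (spot pi i)].

Definition dis pi : nat := \sum_(i < n) (oc pi i - tnth pi i).

Definition unl pi : nat := #|[set i : 'I_n | oc pi i != tnth pi i]|.

Definition perm_des c : nat :=
  #|[set i : 'I_n | [exists j : 'I_n, (j == i.+1 :> nat) && (c j < c i)]]|.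

Definition perm_rlm c : nat :=
  #|[set i : 'I_n | [forall j : 'I_n, (i < j) ==> (c j < c i)]]|.

Definition des pi : nat := perm_des (oc pi)^-1%g.

Definition rlm pi : nat := perm_rlm (oc pi)^-1%g.

Lemma first_freeP occ a (j : 'I_n) :
  reflect [/\ a <= j, j \notin occ
            & forall k : 'I_n, a <= k -> k \notin occ -> j <= k]
          (first_free occ a == Some j).
Proof.
rewrite /first_free; set t := filter _ _.
have mem_t (k : 'I_n) : (k \in t) = (a <= k) && (k \notin occ).
  by rewrite mem_filter mem_enum andbT.
have : sorted (fun x y : 'I_n => x < y) t.
  apply: sorted_filter; first by move=> ? ? ?; apply: ltn_trans.
  have := iota_ltn_sorted 0 n; rewrite -val_enum_ord sorted_map.
  by apply: sub_sorted.
move: t mem_t => [|h t] mem_t /= st.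
  by constructor=> -[aj jo _]; have := mem_t j; rewrite aj jo in_nil.
have h_min k : k \in h :: t -> h <= k.
  rewrite inE => /predU1P[-> //|kt]; apply: ltnW.
  by apply: (allP (order_path_min _ st)) kt => ? ? ?; apply: ltn_trans.
have := mem_t h; rewrite mem_head => /esym/andP[ah ho].
apply: (iffP eqP) => [[<-]|[aj jo j_min]].
  by split=> // k ak ko; apply: h_min; rewrite mem_t ak.
by congr Some; apply/val_inj/eqP; rewrite eqn_leq h_min ?j_min // mem_t aj.
Qed.

Lemma size_park occ s : size (park occ s) = size s.
Proof.
by elim: s occ => //= a s IH occ; case: first_free => [j|] /=; rewrite IH.
Qed.

Lemma uniq_park occ s :
  uniq (pmap id (park occ s)) && all [predC occ] (pmap id (park occ s)).
Proof.
elim: s occ => //= a s IH occ; case E: first_free => [j|] //=.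
have /andP[-> /allP dj] := IH (j |: occ).
have /eqP/first_freeP[_ jo _] := E; rewrite jo andbT /=.
apply/andP; split; first by apply/negP => /dj; rewrite /= setU11.
by apply/allP => k /dj /=; rewrite !inE negb_or => /andP[].
Qed.

Lemma ocE pi i : parking_function pi -> spot pi i = Some (oc pi i).
Proof.
move=> pf; set f := [ffun i => odflt (tnth pi i) (spot pi i)].
have spotE k : spot pi k = Some (f k).
  have /(allP pf) : spot pi k \in park set0 pi.
    by rewrite mem_nth // size_park size_tuple.
  by rewrite ffunE; case: (spot pi k).
have parkE : park set0 pi = map Some (pmap id (park set0 pi)).
  move: pf; rewrite /parking_function.
  by elim: (park _ _) => //= -[b|] //= t IH /IH <-.
have f_inj : injectiveb f.
  apply/injectiveP => j k fjk.
  have : uniq (park set0 pi).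
    rewrite parkE map_inj_uniq; last by move=> ? ? [].
    by case/andP: (uniq_park set0 pi).
  move/uniqP => /(_ None j k); rewrite !inE size_park size_tuple !ltn_ord.
  move=> /(_ isT isT) jk; apply/val_inj/jk.
  by rewrite -[LHS]/(spot pi j) -[RHS]/(spot pi k) !spotE fjk.
have vf : pval (oc pi) = f by rewrite -[LHS]/(val (oc pi)) val_insubd f_inj.
by rewrite spotE -[X in Some X = _](congr1 (fun g : {ffun _} => g i) vf) -pvalE.
Qed.

End Parking.

(* A simple graph on {0..n} is given by its set of edges, which are pairs
   {u, v} of distinct vertices. *)
Section Trees.

Variable n : nat.
Implicit Types (T : {set {set 'I_n.+1}}) (u v i j : 'I_n.+1).

Definition adj T : rel 'I_n.+1 := [rel u v | [set u; v] \in T].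

Definition simple_graph T : bool := [forall e in T, #|e| == 2].

Definition connected T : bool := [forall u, forall v, connect (adj T) u v].

(* No simple cycle of length at least 3; the bound on the length is only there
   to get a boolean, see [acyclicP]. *)
Definition acyclic T : bool :=
  [forall k : 'I_n.+2, forall c : k.-tuple 'I_n.+1,
     ucycleb (adj T) c ==> (k < 3)].

Definition is_tree T : bool := [&& simple_graph T, connected T & acyclic T].

Definition trees : {set {set {set 'I_n.+1}}} := [set T | is_tree T].

(* j lies on a simple path from the root 0 to i; see [on_pathP]. *)
Definition on_path T j i : bool :=
  [exists k : 'I_n.+1, exists p : k.-tuple 'I_n.+1,
     [&& path (adj T) ord0 p, uniq (ord0 :: p), last ord0 p == i
       & j \in (ord0 :: p : seq _)]].

Definition subtree T v : {set 'I_n.+1} := [set u | on_path T v u].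

Definition children T v : {set 'I_n.+1} :=
  [set u | adj T v u && on_path T v u].

Definition inv T : nat :=
  #|[set ij : 'I_n.+1 * 'I_n.+1 | (ij.1 < ij.2) && on_path T ij.2 ij.1]|.

Definition leader T v : bool :=
  (v != ord0) && [forall u in subtree T v, v <= u].

Definition nld T : nat := #|[set v | (v != ord0) && ~~ leader T v]|.

Definition lev T : nat := #|[set v | children T v == set0]|.

Definition deg0 T : nat := #|children T ord0|.

Lemma acyclicP T :
  reflect (forall c, ucycle (adj T) c -> size c < 3) (acyclic T).
Proof.
apply: (iffP forallP) => [acT c cT | acT k].
  have ltc : size c < n.+2.
    have /andP[_ /card_uniqP <-] := cT.
    by rewrite ltnS (leq_trans (max_card _)) ?card_ord.
  by have /forallP/(_ (in_tuple c))/implyP := acT (Ordinal ltc); apply.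
by apply/forallP => c; apply/implyP => /acT; rewrite size_tuple.
Qed.

Lemma on_pathP T j i :
  reflect (exists p, [/\ path (adj T) ord0 p, uniq (ord0 :: p),
                         last ord0 p = i & j \in ord0 :: p])
          (on_path T j i).
Proof.
apply: (iffP existsP) => [[k /existsP[p /and4P[pT Up /eqP lp jp]]] | ].
  by exists p.
case=> p [pT Up lp jp].
have ltp : size p < n.+1.
  have /card_uniqP /= <- := Up.
  by rewrite (leq_trans (max_card _)) ?card_ord.
exists (Ordinal ltp); apply/existsP; exists (in_tuple p).
by apply/and4P; split=> //; apply/eqP.
Qed.

End Trees.

Local Open Scope ring_scope.

(* The polynomials, evaluated at arbitrary elements of a commutative ring; with
   the indeterminates of a polynomial ring over int for x, y, z and w one gets
   the formal polynomials. *)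
Definition P (R : comNzRingType) (n : nat) (x y z w : R) : R :=
  \sum_(pi in PF n) x ^+ unl pi * y ^+ dis pi * z ^+ des pi * w ^+ rlm pi.

(* A finite tree has at least one leaf, so that lev T - 1 is not truncated. *)
Definition Q (R : comNzRingType) (n : nat) (x y z w : R) : R :=
  \sum_(T in trees n)
     x ^+ nld T * y ^+ inv T * z ^+ (lev T - 1) * w ^+ deg0 T.

(* 1 + x y + ... + x y^(m-1) *)
Definition bracket (R : comNzRingType) (m : nat) (x y : R) : R :=
  1 + \sum_(1 <= k < m) x * y ^+ k.

Lemma P0 (R : comNzRingType) (x y z w : R) : P 0 x y z w = 1.
Proof.
rewrite /P (big_pred1 [tuple]); last first.
  by move=> p; rewrite (tuple0 p) /PF in_set [RHS]eqxx.
have E (A : {set 'I_0}) : #|A| = 0%N by apply: eq_card0 => -[].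
by rewrite /unl /dis /des /perm_des /rlm /perm_rlm !E big_ord0 !expr0 !mulr1.
Qed.

Lemma Q0 (R : comNzRingType) (x y z w : R) : Q 0 x y z w = 1.
Proof.
have adjF (T : {set {set 'I_1}}) : simple_graph T -> T = set0.
  move=> /forall_inP sT; apply/setP => e; rewrite inE; apply/negP => /sT /eqP E.
  by have := max_card e; rewrite E card_ord.
rewrite /Q (big_pred1 set0); last first.
  move=> T; rewrite inE; apply/idP/eqP => [/and3P[/adjF] // | ->].
  apply/and3P; split; first by apply/forall_inP => e; rewrite inE.
    by apply/forallP => u; apply/forallP => v; rewrite !ord1 connect0.
  apply/acyclicP => c /andP[_ /card_uniqP <-].
  by rewrite ltnS (leq_trans (max_card _)) ?card_ord.
have ch0 v : children set0 v = set0 :> {set 'I_1}.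
  by apply/setP => u; rewrite [LHS]inE /adj /= !in_set0.
have -> : nld (set0 : {set {set 'I_1}}) = 0%N.
  by apply: eq_card0 => v; rewrite inE [v]ord1 eqxx.
have -> : inv (set0 : {set {set 'I_1}}) = 0%N.
  by apply: eq_card0 => -[u v]; rewrite inE /= [u]ord1 [v]ord1.
have -> : lev (set0 : {set {set 'I_1}}) = 1%N.
  by rewrite /lev -[RHS](card_ord 1); apply: eq_card => v; rewrite inE ch0 eqxx.
by rewrite /deg0 ch0 cards0 !expr0 !mulr1.
Qed.

(* Main.v *)
Require Import Defs.
From mathcomp Require Import all_boot all_order all_fingroup all_algebra.
From mathcomp Require Import zify ring.

(* Both recurrences come from cutting an object in two. A parking function is
   cut at the last car: the spots to its left and to its right are filled
   independently, and a last car parking in the (i+1)-st spot has i + 1 possible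
   preferences, of displacement 0, ..., i. A tree is cut at the edge joining
   the root 0 to the subtree which contains a given non-root vertex m: if that
   subtree has i + 1 vertices, its root is any of them, and choosing the k-th
   smallest one creates k - 1 inversions.

   Neither part is relabelled: the sums are defined over arbitrary sets of cars
   or of vertices. The cut expresses the sum over a set in terms of sums over
   smaller sets, so that by induction it depends on the cardinality only. *)

Set Implicit Arguments.
Unset Strict Implicit.
Unset Printing Implicit Defensive.

Import GRing.Theory.
Local Open Scope ring_scope.

(** * Local weights and the common right-hand side *)

Section Weights.

Variables (R : comNzRingType) (x y z : R).

(* The contribution of a car displaced by d spots, or of a non-root vertex with
   d smaller descendants. *)
Definition phi (d : nat) : R := x ^+ (0 < d)%N * y ^+ d.

Lemma bracketE m : (0 < m)%N -> bracket m x y = \sum_(d < m) phi d.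
Proof.
case: m => // m _; rewrite /bracket big_ord_recl /phi !expr0 mulr1; congr (_ + _).
by rewrite big_add1 big_mkord; apply: eq_bigr => i _; rewrite expr1.
Qed.

Lemma sum_powerset_card (T : finType) (S : {set T}) (F : nat -> R) :
  \sum_(B in powerset S) F #|B| = \sum_(i < #|S|.+1) 'C(#|S|, i)%:R * F i.
Proof.
rewrite (partition_big (fun B : {set T} => inord #|B| : 'I_#|S|.+1) xpredT) //=.
apply: eq_bigr => i _.
rewrite (eq_bigl (mem [set B : {set T} | B \subset S & #|B| == i])); last first.
  move=> B; rewrite !inE; case sBS: (B \subset S) => //=.
  by rewrite -val_eqE /= inordK // ltnS subset_leq_card.
rewrite (eq_bigr (fun _ => F i)); last by move=> B; rewrite !inE => /andP[_ /eqP->].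
by rewrite sumr_const cards_draws mulr_natl.
Qed.

(** Both recurrences have this right-hand side, with [q k u] standing for the value of index [k] at
    [x], [y], [z], [u]: only the last variable is ever specialised. *)
Definition rec_rhs (q : nat -> R -> R) (n : nat) (w : R) : R :=
  bracket n x y * w * q (n - 1)%N 1
  + \sum_(0 <= i < n - 1)
      'C(n - 1, i)%:R * bracket i.+1 x y * z * w * q i 1 * q (n - i - 1)%N w.

(* The exponent of z merges the first term of the recurrence, where nothing is
   left outside of B, into the sum. *)
Lemma rec_rhsE (T : finType) (S : {set T}) (q : nat -> R -> R) (w : R) :
  q 0%N w = 1 ->
  rec_rhs q #|S|.+1 w =
  \sum_(B in powerset S)
     bracket #|B|.+1 x y * w * z ^+ (#|B| < #|S|)%N
       * q #|B| 1 * q (#|S| - #|B|)%N w.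
Proof.
move=> q0; rewrite (sum_powerset_card S (fun k => bracket k.+1 x y * w
  * z ^+ (k < #|S|)%N * q k 1 * q (#|S| - k)%N w)) /rec_rhs subn1 /=.
rewrite big_ord_recr /= addrC binn mul1r ltnn expr0 mulr1 subnn q0 mulr1.
congr (_ + _); rewrite big_mkord; apply: eq_bigr => i _.
rewrite ltn_ord expr1.
have -> : (#|S|.+1 - i - 1 = #|S| - i)%N by have := ltn_ord i; lia.
by rewrite -!mulrA; congr (_ * (_ * _)); rewrite mulrCA.
Qed.

End Weights.

(** * Trees as parent functions *)

Section ParentFunctions.

Variable N : nat.
Implicit Types (A B D : {set 'I_N}) (r u v m : 'I_N) (f g h : {ffun 'I_N -> 'I_N}).

(* A parent function encodes a tree with root r and vertex set r |: A; the
   points outside of A, including r, are fixed. *)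
Definition parent A r f : bool :=
  [forall u, if u \in A then fconnect f u r else f u == u].

Definition ndesc A f v : nat := #|[set u in A | (u < v)%N && fconnect f u v]|.

Lemma parentP A r f :
  reflect ((forall u, u \in A -> fconnect f u r) /\
           (forall u, u \notin A -> f u = u)) (parent A r f).
Proof.
apply: (iffP forallP) => [H|[H1 H2] u].
  by split=> u uA; move: (H u); [rewrite uA | rewrite (negPf uA) => /eqP].
by case: ifP => uA; [apply: H1 | rewrite H2 // uA].
Qed.

(* Only the part of the f-path before it reaches t matters. *)
Lemma fconnect_transfer (K : pred 'I_N) f g u t :
  (forall v, K v -> v != t -> f v = g v /\ K (f v)) ->
  K u -> fconnect f u t -> fconnect g u t.
Proof.
move=> KP Ku /iter_findex; move: (findex f u t) => k; elim: k u Ku => [|k IH] u Ku.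
  by move=> /= ->; apply: connect0.
rewrite iterSr => E; have [->|ut] := eqVneq u t; first exact: connect0.
have [fg Kf] := KP u Ku ut.
by apply: connect_trans (IH _ Kf E); rewrite fg; apply: fconnect1.
Qed.

Lemma fix_iter f u k : f u = u -> iter k f u = u.
Proof. by move=> fu; elim: k => //= k ->. Qed.

Lemma fconnect_fix f u t : f u = u -> fconnect f u t -> u = t.
Proof. by move=> fu /iter_findex; rewrite fix_iter. Qed.

Lemma parent_fix A r f : r \notin A -> parent A r f -> f r = r.
Proof. by move=> rA /parentP[_]; apply. Qed.

Lemma parent_closed A r f u : parent A r f -> u \notin A -> f u \notin A.
Proof. by move=> /parentP[_ H] uA; rewrite H. Qed.

(** Points outside of [A] are fixed, so an orbit that reaches [r] can leave [A] only by stepping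
    onto [r]. *)
Lemma parent_in A r f u : r \notin A -> parent A r f -> u \in A -> f u \in r |: A.
Proof.
move=> rA /parentP[H1 H2] uA; rewrite !inE.
have [|fA] := boolP (f u \in A); first by rewrite orbT.
rewrite orbF; have /iter_findex := H1 u uA.
case: (findex f u r) => [/= E|k]; first by rewrite -E uA in rA.
by rewrite iterSr (fix_iter _ (H2 _ fA)) => ->.
Qed.

Lemma parent_neq A r f u : r \notin A -> parent A r f -> u \in A -> f u != u.
Proof.
move=> rA fP uA; apply: contra rA => /eqP fu.
by have /parentP[H1 _] := fP; rewrite -(fconnect_fix fu (H1 u uA)).
Qed.

(* An orbit which comes back to u never reaches the fixed point r. *)
Lemma fconnect_anti A r f u v : r \notin A -> parent A r f ->
  fconnect f u v -> fconnect f v u -> u = v.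
Proof.
move=> rA fP uv vu; have /parentP[H1 H2] := fP.
have [uA|uA] := boolP (u \in A); last by apply: fconnect_fix uv; apply: H2.
have /iter_findex Ek := H1 u uA.
have /iter_findex Ea := uv; have /iter_findex Eb := vu.
move: (findex f u r) (findex f u v) (findex f v u) Ek Ea Eb => k a b Ek Ea Eb.
case: a Ea => [//|a] Ea.
have Ep : iter (b + a.+1) f u = u by rewrite iterD Ea.
(* Going to [v] and back is a period of [u]. After [k] periods, hence at least [k] steps, the orbit
   is at [u], but it has been stuck at [r] since step [k]. *)
have Eu : iter ((b + a.+1) * k) f u = u.
  by elim: (k) => [|j IH]; rewrite ?muln0 // mulnS iterD IH.
suff ur : u = r by move: rA; rewrite -ur uA.
have /subnK kle : (k <= (b + a.+1) * k)%N by rewrite leq_pmull // addnS.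
by rewrite -Eu -kle iterD Ek fix_iter // (parent_fix rA fP).
Qed.

Lemma parent_top A r f u : r \notin A -> parent A r f -> u \in A ->
  exists v, [/\ v \in A, f v = r & fconnect f u v].
Proof.
move=> rA fP uA; have /parentP[H _] := fP.
have /iter_findex := H u uA; move: (findex f u r) => k.
elim: k u uA => [|k IH] u uA; first by move=> /= E; rewrite -E uA in rA.
rewrite iterSr => E; have /setU1P[fr|fA] := parent_in rA fP uA; first by exists u.
have [v [vA fv uv]] := IH _ fA E.
by exists v; split=> //; apply: connect_trans uv; apply: fconnect1.
Qed.

Lemma ndescE A g f B v : B \subset A ->
  (forall u, u \in A -> fconnect f u v -> u \in B) ->
  (forall u, u \in B -> fconnect f u v = fconnect g u v) ->
  ndesc A f v = ndesc B g v.
Proof.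
move=> BA H1 H2; apply: eq_card => u; rewrite !inE.
have [uB|uB] := boolP (u \in B); first by rewrite (subsetP BA) // H2.
by apply/negP => /and3P[uA _ /(H1 _ uA)]; rewrite (negPf uB).
Qed.

Lemma fconnect_step f u t : fconnect f u t -> u != t -> fconnect f (f u) t.
Proof.
move=> /iter_findex; case: findex => [/= ->|k]; first by rewrite eqxx.
by rewrite iterSr => <- _; apply: fconnect_iter.
Qed.

Lemma fconnect_closed D f u t : (forall v, v \notin D -> f v \notin D) ->
  fconnect f u t -> t \in D -> u \in D.
Proof.
move=> cD /iter_findex <-; apply: contraLR => uD.
by elim: findex => //= k; apply: cD.
Qed.

(** An orbit which has left [D] cannot come back to [t]. It therefore stays in [D], where the two
    maps agree, until it reaches [t]. *)
Lemma fconnect_eq_in D f g u t :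
  (forall v, v \notin D -> f v \notin D) ->
  (forall v, v \notin D -> g v \notin D) ->
  {in D, f =1 g} -> t \in D -> fconnect f u t = fconnect g u t.
Proof.
move=> cf cg fg tD; apply/idP/idP => H.
  apply: (fconnect_transfer (K := fun v => fconnect f v t)) (H) (H) => v vt nvt.
  by rewrite fg ?(fconnect_closed cf vt tD) // -fg ?(fconnect_closed cf vt tD) //;
    split=> //; apply: fconnect_step.
apply: (fconnect_transfer (K := fun v => fconnect g v t)) (H) (H) => v vt nvt.
by rewrite fg ?(fconnect_closed cg vt tD) //; split=> //; apply: fconnect_step.
Qed.

Definition cut D f : {ffun 'I_N -> 'I_N} := [ffun u => if u \in D then f u else u].

Definition glue B v r g h : {ffun 'I_N -> 'I_N} :=
  [ffun u => if u == v then r else if u \in B then g u else h u].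

Definition below f v : {set 'I_N} := [set u | fconnect f u v].

(** The child of the root above [m]. The root is a fixed point, hence the condition [v != r]; the
    default [m] is never taken when [m] is in [A] and [f] is a parent function, see [topP]. *)
Definition top m r f : 'I_N :=
  odflt m [pick v | [&& f v == r, v != r & fconnect f m v]].

(** * Hanging a tree below the root of another one *)

Section Glue.

Variables (A B : {set 'I_N}) (r v m : 'I_N) (g h : {ffun 'I_N -> 'I_N}).
Hypotheses (rA : r \notin A) (BA : B \subset A) (mB : m \in B) (vB : v \in B).
Hypotheses (gP : parent (B :\ v) v g) (hP : parent (A :\: B) r h).

Let f := glue B v r g h.

Let vBv : v \notin B :\ v. Proof. by rewrite setD11. Qed.
Let rAB : r \notin A :\: B. Proof. by rewrite inE negb_and rA orbT. Qed.
Let rB : r \notin B. Proof. by apply: contra rA; apply: subsetP. Qed.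
Let rv : r != v. Proof. by apply: contraNneq rB => ->. Qed.

Lemma glue_root : f v = r. Proof. by rewrite ffunE eqxx. Qed.

Lemma glue_in : {in B :\ v, f =1 g}.
Proof. by move=> u; rewrite !inE ffunE => /andP[/negPf-> ->]. Qed.

Lemma glue_out u : u \notin B -> f u = h u.
Proof.
by move=> uB; rewrite ffunE (negPf uB); case: eqP uB => // ->; rewrite vB.
Qed.

Lemma glue_in_mem u : u \in B :\ v -> f u \in B.
Proof.
move=> uB; rewrite glue_in //; have := parent_in vBv gP uB.
by rewrite !inE => /predU1P[->|/andP[]].
Qed.

Lemma glue_out_mem u : u \in A :\: B -> f u \in r |: A :\: B.
Proof.
by move=> uD; have := uD; rewrite inE => /andP[uB _]; rewrite glue_out ?(parent_in _ hP).
Qed.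

Lemma glue_fix u : u \notin A -> f u = u.
Proof.
move=> uA; rewrite glue_out; last by apply: contra uA; apply: subsetP.
by case/parentP: hP => _; apply; rewrite inE (negPf uA) andbF.
Qed.

Lemma glue_closed_in u : u \notin B :\ v -> f u \notin B :\ v.
Proof.
have [->|uv] := eqVneq u v; first by rewrite glue_root !inE (negPf rB) andbF.
rewrite !inE uv /= => uB; have [uA|uA] := boolP (u \in A); last first.
  by rewrite glue_fix // (negPf uB) andbF.
have := glue_out_mem (u := u); rewrite !inE uA uB
  => /(_ isT) /predU1P[->|/andP[/negPf-> _]].
  by rewrite (negPf rB) andbF.
by rewrite andbF.
Qed.

Lemma glue_closed_out u : u \notin A :\: B -> f u \notin A :\: B.
Proof.
have [->|uv] := eqVneq u v; first by rewrite glue_root.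
rewrite !inE negb_and negbK; have [uB _|uB /= uA] := boolP (u \in B).
  by rewrite glue_in_mem // !inE uv.
by rewrite glue_fix // uB.
Qed.

Lemma glue_connect_in u t : t \in B :\ v -> fconnect f u t = fconnect g u t.
Proof.
apply: fconnect_eq_in; [exact: glue_closed_in| |exact: glue_in].
by move=> s; apply: parent_closed gP.
Qed.

Lemma glue_connect_out u t : t \in A :\: B -> fconnect f u t = fconnect h u t.
Proof.
apply: fconnect_eq_in; [exact: glue_closed_out| |].
  by move=> s; apply: parent_closed hP.
by move=> s; rewrite inE => /andP[sB _]; apply: glue_out.
Qed.

(** Outside of [B] no vertex has its parent in [B]; inside, the path to [v] for [g] is also one for
    [f]. *)
Lemma glue_connect_root u : fconnect f u v = (u \in B).
Proof.
apply/idP/idP => [uv|uB].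
  apply: (fconnect_closed _ uv vB) => s sB; have [sA|sA] := boolP (s \in A).
    have := glue_out_mem (u := s); rewrite !inE sB sA => /(_ isT).
    by case/predU1P=> [->|/andP[]].
  by rewrite glue_fix.
have [->|nuv] := eqVneq u v; first exact: connect0.
have uBv : u \in B :\ v by rewrite !inE nuv.
have /parentP[gc gf] := gP.
apply: (fconnect_transfer (K := mem B)) uB (gc _ uBv) => s sB sv.
have sBv : s \in B :\ v by apply/setD1P.
by rewrite -glue_in //; split=> //; apply: glue_in_mem.
Qed.

Lemma glue_parent : parent A r f.
Proof.
apply/parentP; split=> [u uA|]; last exact: glue_fix.
have [uB|uB] := boolP (u \in B).
  apply: (connect_trans (y := v)); first by rewrite glue_connect_root.
  by rewrite -glue_root; apply: fconnect1.
have uD : u \in A :\: B by rewrite inE uB.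
have /parentP[hc _] := hP.
apply: (fconnect_transfer (K := mem (r |: A :\: B))) (hc _ uD).
  move=> s /setU1P[-> /eqP//|sD _]; rewrite -glue_out; last by case/setDP: sD.
  by split=> //; apply: glue_out_mem.
by apply/setU1P; right.
Qed.

Lemma glue_below : below f v = B.
Proof. by apply/setP => u; rewrite inE glue_connect_root. Qed.

(** There is only one child of [r] above [m]: two points of the orbit of [m] are comparable, and one
    step after a child of [r] the orbit is stuck at [r]. *)
Lemma glue_top : top m r f = v.
Proof.
have rf : f r = r := parent_fix rA glue_parent.
rewrite /top; case: pickP => [u /and3P[/eqP fu ur mu]|/(_ v)]; last first.
  by rewrite glue_root eqxx eq_sym rv glue_connect_root mB.
have mv : fconnect f m v by rewrite glue_connect_root.
have key s t : f s = r -> s != r -> fconnect f s t -> f t = r -> t != r -> s = t.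
  move=> fs sr st ft tr; apply: contraNeq tr => nst.
  have := fconnect_step st nst; rewrite fs => /(fconnect_fix rf) <-.
  by [].
have rv' : v != r by rewrite eq_sym.
have [/eqP uv|uv] := boolP (u == v); first by [].
have [H|H] : fconnect f u v \/ fconnect f v u.
- have /iter_findex Eu := mu; have /iter_findex Ev := mv.
  have [le|/ltnW le] := leqP (findex f m u) (findex f m v); [left|right].
    by rewrite -Ev -(subnK le) iterD Eu fconnect_iter.
  by rewrite -Eu -(subnK le) iterD Ev fconnect_iter.
- by apply: key => //; apply: glue_root.
by apply/esym; apply: key => //; apply: glue_root.
Qed.

Lemma cut_glue_in : cut (B :\ v) f = g.
Proof.
apply/ffunP => u; rewrite ffunE; case: ifP => [/glue_in//|uB].
by have /parentP[_ ->] := gP; rewrite ?uB.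
Qed.

Lemma cut_glue_out : cut (A :\: B) f = h.
Proof.
apply/ffunP => u; rewrite ffunE; case: ifP => [|uB].
  by rewrite inE => /andP[uB _]; apply: glue_out.
by have /parentP[_ ->] := hP; rewrite ?uB.
Qed.

Lemma ndesc_glue_in t : t \in B :\ v -> ndesc A f t = ndesc (B :\ v) g t.
Proof.
move=> tB; apply: ndescE => [|u uA ut|u uB]; last exact: glue_connect_in.
  by apply: subset_trans BA; apply: subD1set.
exact: fconnect_closed glue_closed_in ut tB.
Qed.

Lemma ndesc_glue_out t : t \in A :\: B -> ndesc A f t = ndesc (A :\: B) h t.
Proof.
move=> tB; apply: ndescE => [|u uA ut|u uB]; last exact: glue_connect_out.
  exact: subsetDl.
exact: fconnect_closed glue_closed_out ut tB.
Qed.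

Lemma ndesc_glue_root : ndesc A f v = #|[set u in B | (u < v)%N]|.
Proof.
apply: eq_card => u; rewrite !inE glue_connect_root.
have [uB|] := boolP (u \in B); last by rewrite !andbF.
by rewrite (subsetP BA) // andbT.
Qed.

Lemma image_glue :
  f @: A = r |: (g @: (B :\ v)) :|: (h @: (A :\: B)).
Proof.
apply/setP => t; rewrite !inE; apply/imsetP/idP => [[u uA ->]|].
  have [->|uv] := eqVneq u v; first by rewrite glue_root eqxx.
  have [uB|uB] := boolP (u \in B).
    have uBv : u \in B :\ v by rewrite !inE uv.
    by rewrite (glue_in uBv) (imset_f g uBv) orbT.
  have uAB : u \in A :\: B by rewrite inE uB.
  by rewrite (glue_out uB) (imset_f h uAB) orbT.
case/orP=> [/predU1P[->|/imsetP[u uB ->]]|/imsetP[u uB ->]].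
- by exists v; rewrite ?glue_root // (subsetP BA).
- exists u; last by rewrite glue_in.
  by move: uB; rewrite inE => /andP[_ /(subsetP BA)].
by exists u; move: uB; rewrite inE => /andP[uB uA]; rewrite ?glue_out.
Qed.

Let subn_split a b c d : (c <= a)%N -> (true + d <= b)%N ->
  (a + 1 + b - (c + 1 + d) = a - c + true + (b - (true + d)))%N.
Proof. by clear; lia. Qed.

(** The leaves of the glued tree are those of the two pieces, except that [r], when it is alone in
    the outer piece, stops being a leaf. As each difference is a number of leaves minus one, the
    correction is 1 when the outer piece has a further vertex and 0 otherwise. *)
Lemma card_image_glue :
  (#|A| - #|f @: A| = (#|B :\ v| - #|g @: (B :\ v)|)
     + (B \proper A) + (#|A :\: B| - #|h @: (A :\: B)|))%N.
Proof.
have cA : #|A| = (#|B :\ v| + 1 + #|A :\: B|)%N.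
  by rewrite -(cardsID B A) (setIidPr BA) (cardsD1 v B) vB [(true + _)%N]addnC.
have lg : (#|g @: (B :\ v)| <= #|B :\ v|)%N by apply: leq_imset_card.
have lh : (#|h @: (A :\: B)| <= #|A :\: B|)%N by apply: leq_imset_card.
have gB : g @: (B :\ v) \subset B.
  by apply/subsetP => _ /imsetP[u uB ->]; rewrite -glue_in // glue_in_mem.
have hB : h @: (A :\: B) \subset r |: A :\: B.
  apply/subsetP => _ /imsetP[u uB ->]; rewrite -glue_out ?glue_out_mem //.
  by move: uB; rewrite inE => /andP[].
(* The only vertex that can have children both in the inner part of the image and in the outer piece
   is [r], already counted as the parent of [v]; removing it makes the union disjoint. *)
have dis1 : [disjoint r |: g @: (B :\ v) & (h @: (A :\: B)) :\ r].
  rewrite disjoints_subset; apply/subsetP => u; rewrite !inE negb_and negbK.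
  case/predU1P=> [->|/(subsetP gB) uB]; first by rewrite eqxx.
  apply/orP; right; apply/negP => /(subsetP hB); rewrite !inE uB /= orbF.
  by move=> /eqP E; move: rB; rewrite -E uB.
have E : f @: A = (r |: g @: (B :\ v)) :|: (h @: (A :\: B)) :\ r.
  rewrite image_glue; apply/setP => u; rewrite !inE.
  by case: (u == r).
have rg : r \notin g @: (B :\ v) by apply: contra rB; apply: subsetP.
have cf : #|f @: A| = (#|g @: (B :\ v)| + 1 + #|h @: (A :\: B) :\ r|)%N.
  by rewrite E cardsU (disjoint_setI0 dis1) cards0 subn0 cardsU1 rg add1n addn1.
have := cardsD1 r (h @: (A :\: B)).
have [/properP[_ [u uA uB]]|nBA] := boolP (B \proper A).
  have uD : u \in A :\: B by rewrite inE uB.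
  have [t [tD ht _]] := parent_top rAB hP uD.
  have -> : r \in h @: (A :\: B) by rewrite -ht imset_f.
  move=> hr; rewrite hr in lh *; rewrite cf cA.
  exact: subn_split.
have AB : A :\: B = set0.
  by apply/eqP; rewrite setD_eq0; apply: contraR nBA => AB; rewrite properE BA.
move=> _; rewrite cf cA AB imset0 set0D !cards0.
by rewrite subn0 !addn0 subnDr.
Qed.

Lemma deg_glue :
  #|[set u in A | f u == r]| = #|[set u in A :\: B | h u == r]|.+1.
Proof.
rewrite (cardsD1 v) inE (subsetP BA) // glue_root eqxx; congr _.+1.
apply: eq_card => u; rewrite !inE.
have [->|uv] := eqVneq u v; first by rewrite vB.
have [uB|uB] /= := boolP (u \in B); last by rewrite glue_out.
apply/negP => /andP[_ /eqP fu].
by have := glue_in_mem (u := u); rewrite !inE uv uB fu (negPf rB) => /(_ isT).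
Qed.

End Glue.

(** * Cutting a tree at the child of the root above [m] *)

Section Split.

Variables (A : {set 'I_N}) (r m : 'I_N) (f : {ffun 'I_N -> 'I_N}).
Hypotheses (rA : r \notin A) (mA : m \in A) (fP : parent A r f).

Let v := top m r f.
Let B := below f v.

Lemma topP : [/\ f v = r, v \in A & fconnect f m v].
Proof.
rewrite /v /top; case: pickP => [u /and3P[/eqP fu ur mu]|H] /=.
  by split=> //; apply: contraR ur => uA; have /parentP[_ H] := fP; rewrite -fu H.
have [u [uA fu mu]] := parent_top rA fP mA.
have := H u; rewrite fu eqxx mu /= andbT => /negbFE/eqP E.
by move: rA; rewrite -E uA.
Qed.

Lemma below_sub : B \subset A.
Proof.
have [_ vA _] := topP.
apply/subsetP => u; rewrite inE => uv; apply: contraLR vA => uA.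
by rewrite -(fconnect_fix _ uv) //; case/parentP: fP => _; apply.
Qed.

Lemma top_below : v \in B. Proof. by rewrite inE connect0. Qed.

Lemma cut_in_parent : parent (B :\ v) v (cut (B :\ v) f).
Proof.
apply/parentP; split=> u uD; last by rewrite ffunE (negPf uD).
have /setD1P[_ uB] := uD; have uv := uB; rewrite inE in uv.
apply: (fconnect_transfer (K := mem B)) uB uv => s sB sv.
have sD : s \in B :\ v by apply/setD1P.
rewrite ffunE sD; split=> //; have : s \in B := sB.
by rewrite -[_ (f s)]/(f s \in B) !inE => /fconnect_step; apply.
Qed.

(** A vertex whose parent lies below [v] lies below [v] itself, so a path to the root which starts
    outside of [B] stays outside. *)
Lemma cut_out_parent : parent (A :\: B) r (cut (A :\: B) f).
Proof.
apply/parentP; split=> u uD; last by rewrite ffunE (negPf uD).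
have ur : fconnect f u r by case/setDP: uD => uA _; case/parentP: fP => H _; apply: H.
apply: (fconnect_transfer (K := mem (r |: A :\: B))) (ur); last by apply/setU1P; right.
move=> s /setU1P[->|sD _]; first by rewrite eqxx.
rewrite ffunE sD; split=> //; have /setDP[sA sB] := sD.
have /setU1P[->|fA] := parent_in rA fP sA; first exact: setU11.
apply/setU1P; right; rewrite inE fA andbT.
apply: contra sB; rewrite !inE; apply: connect_trans; exact: fconnect1.
Qed.

Lemma glue_cut : glue B v r (cut (B :\ v) f) (cut (A :\: B) f) = f.
Proof.
have [fv _ _] := topP.
apply/ffunP => u; rewrite !ffunE !in_setD1 in_setD.
have [->|_] := eqVneq u v; first by rewrite fv.
have [|uB] //= := boolP (u \in B).
by case: ifP => // /negbT uA; case/parentP: fP => _ ->.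
Qed.

End Split.

End ParentFunctions.

(** * Sums over trees *)

Section TreeSums.

Variables (R : comNzRingType) (x y z : R).

(* There are #|A| + 1 vertices, and f @: A consists of those which are not
   leaves. *)
Definition tree_weight N (A : {set 'I_N}) r w (f : {ffun 'I_N -> 'I_N}) : R :=
  \prod_(v in A) phi x y (ndesc A f v) * z ^+ (#|A| - #|f @: A|)
    * w ^+ #|[set u in A | f u == r]|.

Definition tree_sum N (A : {set 'I_N}) r w : R :=
  \sum_(f | parent A r f) tree_weight A r w f.

Lemma tree_sum0 N (r : 'I_N) w : tree_sum set0 r w = 1.
Proof.
rewrite /tree_sum (big_pred1 [ffun u => u]) => [|f].
  rewrite /tree_weight big_set0 cards0 sub0n !expr0 !mul1r.
  by rewrite eq_card0 ?expr0 // => u; rewrite !inE.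
apply/parentP/eqP => [[_ H]|->].
  by apply/ffunP => u; rewrite ffunE H // inE.
by split=> u; rewrite ?inE // ffunE.
Qed.

(** Remove the greatest element: its rank is [#|B| - 1], and the other ranks do not change. This
    evaluates the sum over the possible roots of a subtree with vertex set [B]. *)
Lemma sum_rank N (B : {set 'I_N}) (F : nat -> R) :
  \sum_(v in B) F #|[set u in B | (u < v)%N]| = \sum_(d < #|B|) F d.
Proof.
move: {2}#|B| (erefl #|B|) => k; elim: k B => [|k IH] B cB.
  by rewrite cB big_ord0 (cards0_eq cB) big_set0.
have [v0 v0B] : exists v, v \in B by apply/card_gt0P; rewrite cB.
have [m mB mmax] := arg_maxnP (fun v : 'I_N => val v) v0B.
have {}mB : m \in B := mB.
have ltm v : v \in B -> v != m -> (v < m)%N.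
  by move=> vB vm; rewrite ltn_neqAle vm; apply: mmax.
have cBm : #|B :\ m| = k by move: cB; rewrite (cardsD1 m) mB => -[].
rewrite (big_setD1 m) //= cB big_ord_recr /= -cBm -IH // addrC; congr (_ + _).
  apply: eq_bigr => v /setD1P[vm vB]; congr F; apply: eq_card => u; rewrite !inE.
  by have [->|//] := eqVneq u m; rewrite ltnNge ltnW ?ltm // andbF.
congr F; apply: eq_card => u; rewrite !inE.
by have [->|um] := eqVneq u m; rewrite ?ltnn ?andbF //=;
  case: (boolP (u \in B)) => // /ltm->.
Qed.

(** All vertices but [v] keep their smaller descendants, and [v] has all of [B] below it. The factor
    [w] counts [v] as a new child of the root; the children of [v] do not count towards the degree
    of [r], whence the argument 1 for [g]. *)
Lemma tree_weight_glue N (A B : {set 'I_N}) r v g h w :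
  r \notin A -> B \subset A -> v \in B ->
  parent (B :\ v) v g -> parent (A :\: B) r h ->
  tree_weight A r w (glue B v r g h) =
  phi x y #|[set u in B | (u < v)%N]| * (w * z ^+ (B \proper A))
   * (tree_weight (B :\ v) v 1 g * tree_weight (A :\: B) r w h).
Proof.
move=> rA BA vB gP hP; rewrite /tree_weight.
rewrite (deg_glue h rA BA vB gP) (card_image_glue rA BA vB gP hP).
rewrite (big_setID B) /= (setIidPr BA) (big_setD1 v) //=.
rewrite (ndesc_glue_root rA BA vB gP hP) expr1n mulr1.
rewrite (eq_bigr _ (fun t tB =>
  congr1 _ (ndesc_glue_in rA BA vB gP hP tB))).
rewrite [X in _ * X * _ * _ = _](eq_bigr _ (fun t tB =>
  congr1 _ (ndesc_glue_out rA BA vB gP hP tB))).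
rewrite !exprD exprS; move: (phi _ _ _) (\prod_(i in _) _) (\prod_(i in _) _).
move: (z ^+ _) (z ^+ _) (z ^+ _) (w ^+ _) => a b c d p p1 p2; ring.
Qed.

Lemma tree_sum_split N (A : {set 'I_N}) r m w : r \notin A -> m \in A ->
  tree_sum A r w =
  \sum_(B : {set 'I_N} | (B \subset A) && (m \in B)) \sum_(v in B)
     phi x y #|[set u in B | (u < v)%N]| * (w * z ^+ (B \proper A))
      * (tree_sum (B :\ v) v 1 * tree_sum (A :\: B) r w).
Proof.
move=> rA mA; rewrite pair_big_dep /=.
under [RHS]eq_bigr => p _ do rewrite /tree_sum big_distrlr /= pair_big /= mulr_sumr.
rewrite pair_big_dep /= /tree_sum.
rewrite (reindex_onto
  (fun p : ({set 'I_N} * 'I_N) * ({ffun 'I_N -> 'I_N} * {ffun 'I_N -> 'I_N}) =>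
     glue p.1.1 p.1.2 r p.2.1 p.2.2)
  (fun f => let v := top m r f in let B := below f v in
     ((B, v), (cut (B :\ v) f, cut (A :\: B) f)))) /=; last first.
  by move=> f fP; apply: glue_cut.
(* A quadruple consists of a block, a root in it and two parent functions exactly when its gluing is
   a parent function that is cut back into the same quadruple. *)
symmetry; apply: eq_big => [[[B v] [g h]]|[[B v] [g h]]] /=.
  apply/idP/idP => [/and3P[/andP[/andP[BA mB] vB] gP hP]|].
    rewrite (glue_parent rA BA vB gP hP) (glue_top rA BA mB vB gP hP).
    rewrite (glue_below rA BA vB gP hP).
    by rewrite (cut_glue_in r h gP) (cut_glue_out g vB hP) eqxx.
  move: (glue B v r g h) => f /andP[fP /eqP[<- <- <- <-]].
  have [_ vA mv] := topP rA mA fP.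
  by rewrite below_sub // inE mv top_below cut_in_parent ?cut_out_parent.
by case/and3P=> /andP[/andP[BA mB] vB] gP hP; rewrite (tree_weight_glue _ rA BA vB gP hP).
Qed.

End TreeSums.

Section TreeRec.

Variables (R : comNzRingType) (x y z : R).

(** Any [m] in [A] can serve for the cut. As [q] is arbitrary and only compared with the sums over
    smaller sets, this serves both inside the induction of [tree_sum_card] and for [Q] itself. *)
Lemma tree_sum_rec (q : nat -> R -> R) N (A : {set 'I_N}) r w :
  r \notin A -> (0 < #|A|)%N -> q 0%N w = 1 ->
  (forall (B : {set 'I_N}) s u, s \notin B -> (#|B| < #|A|)%N ->
     tree_sum x y z B s u = q #|B| u) ->
  tree_sum x y z A r w = rec_rhs x y z q #|A| w.
Proof.
move=> rA /card_gt0P[m mA] q0 IH.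
rewrite (tree_sum_split _ _ _ _ rA mA) [in RHS](cardsD1 m) mA rec_rhsE //.
(* The block containing [m] is written [m |: B], which turns the sum into one over the subsets of
   [A :\ m], as in [rec_rhsE]. *)
rewrite (reindex_onto (fun B => m |: B) (fun B => B :\ m)) /=; last first.
  by move=> B /andP[_ mB]; rewrite setD1K.
apply: eq_big => [B|B /andP[/andP[BA _] /eqP mB]].
  rewrite powersetE setU11 andbT subUset sub1set mA /= subsetD1.
  congr (_ && _); apply/eqP/idP => [<-|]; first by rewrite setD11.
  by apply: setU1K.
have {}mB : m \notin B by rewrite -mB setD11.
have cB : #|m |: B| = #|B|.+1 by rewrite cardsU1 mB.
have cA : #|A| = #|A :\ m|.+1 by rewrite (cardsD1 m) mA.
have BAm : (#|B| <= #|A :\ m|)%N.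
  by rewrite -ltnS -cA -cB subset_leq_card.
have cD : #|A :\: (m |: B)| = (#|A :\ m| - #|B|)%N.
  by rewrite cardsD (setIidPr BA) cB cA subSS.
rewrite bracketE // -cB -sum_rank !mulr_suml; apply: eq_bigr => v vB.
have cv : #|(m |: B) :\ v| = #|B| by move: cB; rewrite (cardsD1 v) vB => -[].
rewrite IH ?setD11 ?cv ?cA // IH ?cD ?inE ?negb_and ?rA ?orbT //; last first.
  by rewrite cA ltnS leq_subr.
by rewrite properEcard BA cB cA ltnS !mulrA.
Qed.

(** Strong induction on [#|A|]: the sums over [A] and over the standard set of the same size both
    equal [rec_rhs], taken at the standard sums of smaller index. *)
Lemma tree_sum_card N (A : {set 'I_N}) r w : r \notin A ->
  tree_sum x y z A r w = tree_sum x y z [set~ (ord0 : 'I_#|A|.+1)] ord0 w.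
Proof.
pose q n u := tree_sum x y z [set~ (ord0 : 'I_n.+1)] ord0 u.
have cq n : #|[set~ (ord0 : 'I_n.+1)]| = n by rewrite cardsC1 card_ord.
have q0 u : q 0%N u = 1.
  by rewrite /q (cards0_eq (cq 0%N)) tree_sum0.
move: {2}#|A|.+1 (ltnSn #|A|) => k.
elim: k N A r w => [//|k IH] N A r w; rewrite ltnS => cA rA.
have [A0|A_gt0] := posnP #|A|.
  by rewrite -[RHS]/(q _ _) A0 q0 (cards0_eq A0) tree_sum0.
have step M (B : {set 'I_M}) s : s \notin B -> #|B| = #|A| ->
    tree_sum x y z B s w = rec_rhs x y z q #|A| w.
  move=> sB cB; rewrite -cB; apply: tree_sum_rec; rewrite ?cB //.
  by move=> C t u tC cC; rewrite IH // (leq_trans cC).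
by rewrite !step ?cq ?inE ?eqxx.
Qed.

End TreeRec.

(** * From trees to parent functions *)

Section TreesOfParents.

Variable n : nat.
Implicit Types (f : {ffun 'I_n.+1 -> 'I_n.+1}) (T : {set {set 'I_n.+1}}).
Implicit Types (u v i j : 'I_n.+1).

Let A : {set 'I_n.+1} := [set~ ord0].

Definition edges f : {set {set 'I_n.+1}} := [set [set v; f v] | v in [set~ ord0]].

Lemma adj_sym T : symmetric (adj T).
Proof. by move=> u v; rewrite /adj /= setUC. Qed.

Lemma ord0_notin : ord0 \notin A. Proof. by rewrite !inE eqxx. Qed.

Section OneParent.

Variable f : {ffun 'I_n.+1 -> 'I_n.+1}.
Hypothesis fP : parent A ord0 f.

Let f0 : f ord0 = ord0 := parent_fix ord0_notin fP.

Let f_neq u : u != ord0 -> f u != u.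
Proof. by move=> u0; apply: (parent_neq ord0_notin fP); rewrite !inE. Qed.

Let f_root u : fconnect f u ord0.
Proof.
have [->|u0] := eqVneq u ord0; first exact: connect0.
by case/parentP: fP => H _; apply: H; rewrite !inE.
Qed.

Let f_anti u v : fconnect f u v -> fconnect f v u -> u = v.
Proof. exact: (fconnect_anti ord0_notin fP). Qed.

Lemma adj_edges u v :
  adj (edges f) u v = (u != ord0) && (f u == v) || (v != ord0) && (f v == u).
Proof.
apply/imsetP/orP => [[t]|].
  rewrite !inE => t0 E; have ft := f_neq t0.
  have : u \in [set t; f t] by rewrite -E set21.
  have : v \in [set t; f t] by rewrite -E set22.
  have : t \in [set u; v] by rewrite E set21.
  have : f t \in [set u; v] by rewrite E set22.
  rewrite !inE => F1 F2 /orP[]/eqP Ev /orP[]/eqP Eu; subst u v.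
  - by move: F1; rewrite (negPf ft).
  - by right; rewrite t0 eqxx.
  - by left; rewrite t0 eqxx.
  by move: F2; rewrite eq_sym (negPf ft).
case=> /andP[u0 /eqP E]; [exists u|exists v]; rewrite ?inE ?E //.
by rewrite setUC.
Qed.

Lemma adj_parent u : u != ord0 -> adj (edges f) (f u) u.
Proof. by move=> u0; rewrite adj_edges u0 eqxx orbT. Qed.

(* A simple path from the root can never go up towards the root. *)
Lemma simple_path_down p : path (adj (edges f)) ord0 p -> uniq (ord0 :: p) ->
  path [rel u v | f v == u] ord0 p.
Proof.
(* For the induction, the path starts at the root or just after the parent of its first vertex has
   been left behind; in both cases it cannot go up. *)
have gen u q : (u = ord0 \/ f u \notin q) -> path (adj (edges f)) u q ->
    uniq (u :: q) -> path [rel u v | f v == u] u q.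
  elim: q u => //= v q IH u Hu /andP[auv pq] /andP[]; rewrite inE negb_or.
  case/andP=> uv uq /andP[vq Uq].
  have fv : f v = u.
    move: auv; rewrite adj_edges => /orP[/andP[u0 /eqP fu]|/andP[_ /eqP //]].
      by case: Hu => [E|]; [rewrite E eqxx in u0 | rewrite fu inE eqxx].
  by rewrite fv eqxx /=; apply: IH => //=; [right; rewrite fv | rewrite vq].
by move=> pp Up; apply: gen => //; left.
Qed.

Lemma down_path_mem p j : path [rel u v | f v == u] ord0 p ->
  (j \in ord0 :: p) = fconnect f (last ord0 p) j.
Proof.
elim/last_ind: p j => [|p v IH] j /=.
  move=> _; rewrite inE; apply/eqP/idP => [->|]; first exact: connect0.
  by move/(fconnect_fix f0).
rewrite rcons_path last_rcons => /andP[pp /= /eqP fv].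
rewrite -rcons_cons mem_rcons inE IH // -fv.
apply/orP/idP => [[/eqP->|]|vj]; first exact: connect0.
  by apply: connect_trans; apply: fconnect1.
have [->|nvj] := eqVneq v j; [by left | right].
exact: fconnect_step vj nvj.
Qed.

Lemma connect_edges u : connect (adj (edges f)) ord0 u.
Proof.
have /iter_findex := f_root u; move: (findex _ _ _) => k.
elim: k u => [|k IH] u /=; first by move=> ->; apply: connect0.
have [->|u0] := eqVneq u ord0; first by rewrite connect0.
rewrite -iterS iterSr => E; apply: connect_trans (IH _ E) _.
exact/connect1/adj_parent.
Qed.

Lemma on_path_edges j i : on_path (edges f) j i = fconnect f i j.
Proof.
apply/on_pathP/idP => [[p [pp Up <- jp]]|ij].
  by rewrite -down_path_mem //; apply: simple_path_down.
have /connectP[p pp Ei] := connect_edges i; move: ij; rewrite {}Ei.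
case/shortenP: pp => q pq Uq _ jq; exists q; split=> //.
by rewrite down_path_mem //; apply: simple_path_down.
Qed.

(** The number of ancestors serves as the depth of a vertex in the proof of acyclicity. *)
Lemma card_ancestors u : u != ord0 ->
  (#|[set t | fconnect f (f u) t]| < #|[set t | fconnect f u t]|)%N.
Proof.
move=> u0; apply/proper_card/properP; split.
  apply/subsetP => t; rewrite !inE; apply: connect_trans; exact: fconnect1.
exists u; rewrite !inE ?connect0 //; apply: contra (f_neq u0) => fu.
by apply/eqP; apply: f_anti => //; apply: fconnect1.
Qed.

Lemma edges_tree : is_tree (edges f).
Proof.
apply/and3P; split.
- apply/forall_inP => e /imsetP[v]; rewrite !inE => v0 ->.
  by rewrite cards2 (eq_sym v) f_neq.
- apply/forallP => u; apply/forallP => v; apply: connect_trans (connect_edges v).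
  by rewrite (sym_connect_sym (@adj_sym _)) connect_edges.
(* Both neighbours on a cycle of its deepest vertex x would be f x. *)
apply/acyclicP => c /andP[cc Uc]; rewrite leqNgt; apply/negP => c3.
have [x0 x0c] : exists x, x \in c
  by case: c c3 {cc Uc} => // x c _; exists x; rewrite mem_head.
have [x xc xmax] := arg_maxnP (fun u => #|[set t | fconnect f u t]|) x0c.
have up v : v \in c -> adj (edges f) x v -> v = f x.
  move=> vc; rewrite adj_edges => /orP[/andP[_ /eqP //]|/andP[v0 /eqP fv]].
  by have := card_ancestors v0; rewrite fv ltnNge; rewrite [(_ <= _)%N](xmax v vc).
(* Once the cycle is rotated to start at [x], the neighbours of [x] are its second and its last
   vertex, which differ since the length is at least 3. *)
have [k c' Ec] := rot_to xc.
have memc v : (v \in x :: c') = (v \in c) by rewrite -Ec mem_rot.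
move: cc Uc c3 memc; rewrite -(rot_cycle k) -(rot_uniq k) -(size_rot k c) Ec.
case: c' {Ec} => [|v [|w s]] //= /andP[av].
rewrite rcons_path => /and3P[_ _ az] /and3P[_ vws _] _ memc.
have Ev : v = f x by apply: up; rewrite // -memc !inE eqxx orbT.
have Ew : last w s = f x.
  by apply: up; rewrite 1?adj_sym // -memc 2!in_cons mem_last !orbT.
by move: vws; rewrite Ev -Ew mem_last.
Qed.

Lemma children_edges v : children (edges f) v = [set u in A | f u == v].
Proof.
apply/setP => u; rewrite !inE adj_edges on_path_edges.
apply/andP/andP => [[/orP[/andP[v0 /eqP fv] uv|/andP//]]|[u0 /eqP fu]].
  have E : u = v by apply: f_anti => //; rewrite -fv; apply: fconnect1.
  by move: (f_neq v0); rewrite fv E eqxx.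
by rewrite u0 fu eqxx orbT -fu fconnect1.
Qed.

Lemma deg0_edges : deg0 (edges f) = #|[set u in A | f u == ord0]|.
Proof. by rewrite /deg0 children_edges. Qed.

Lemma lev_edges : (lev (edges f) - 1 = #|A| - #|f @: A|)%N.
Proof.
have -> : lev (edges f) = #|~: (f @: A)|.
  apply: eq_card => v; rewrite !inE children_edges.
  apply/eqP/negP => [H /imsetP[u uA E]|H].
    by have /setP/(_ u) := H; rewrite !inE E eqxx andbT; move: uA; rewrite !inE => ->.
  apply/setP => u; rewrite !inE; apply/negP => /andP[u0 /eqP fu].
  by apply: H; rewrite -fu imset_f // !inE.
have := cardsC (f @: A); have := cardsC A; rewrite !card_ord setCK cards1.
by move: #|A| #|f @: A| #|~: _| => a b c; clear; lia.
Qed.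

Let ndesc_edges v : v != ord0 ->
  ndesc A f v = #|[set u : 'I_n.+1 | (u < v)%N && on_path (edges f) v u]|.
Proof.
move=> v0; apply: eq_card => u; rewrite !inE on_path_edges.
have [->|//] := eqVneq u ord0; apply/esym/negP => /andP[_ /(fconnect_fix f0) E].
by rewrite -E eqxx in v0.
Qed.

Lemma inv_edges : Defs.inv (edges f) = (\sum_(v in A) ndesc A f v)%N.
Proof.
rewrite /Defs.inv -sum1_card (partition_big snd (mem A)) /= => [|[i j]]; last first.
  by rewrite !inE /= => /andP[ij _]; rewrite -val_eqE /= -lt0n (leq_ltn_trans _ ij).
apply: eq_bigr => v; rewrite !inE => v0; rewrite ndesc_edges //.
transitivity #|[set ij : 'I_n.+1 * 'I_n.+1 |
    [&& (ij.1 < ij.2)%N, on_path (edges f) ij.2 ij.1 & ij.2 == v]]|.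
  by rewrite -[RHS]sum1_card; apply: eq_bigl => ij; rewrite !inE andbA.
rewrite -(card_imset (f := fun u => (u, v))); last by move=> u t [].
apply: eq_card => -[i j]; rewrite !inE /=.
apply/and3P/imsetP => [[ij p /eqP E]|[u]]; first by exists i; rewrite ?inE -?E ?ij.
by rewrite inE => /andP[uv p] [-> ->].
Qed.

Lemma nld_edges : nld (edges f) = (\sum_(v in A) (0 < ndesc A f v))%N.
Proof.
rewrite -big_mkcondr /nld -sum1_card; apply: eq_bigl => v; rewrite !inE /leader.
case: eqVneq => //= v0; rewrite ndesc_edges //.
apply/forallPn/card_gt0P => [[u]|[u]].
  by rewrite negb_imply inE -ltnNge => /andP[vu uv]; exists u; rewrite inE uv.
by rewrite inE => /andP[uv vu]; exists u; rewrite negb_imply inE vu -ltnNge.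
Qed.

End OneParent.

(** If the edge from [v] to [f v] is not the one from [v] to [g v], then [v] is the parent of [f v]
    for [g]. Ancestry can be read off the edges, so [v] is also an ancestor of [f v] for [f], which
    is absurd. *)
Lemma edges_inj : {in [pred f | parent A ord0 f] &, injective edges}.
Proof.
move=> f g fP gP E; apply/ffunP => v.
have [->|v0] := eqVneq v ord0.
  by rewrite (parent_fix ord0_notin fP) (parent_fix ord0_notin gP).
have vA : v \in A by rewrite !inE.
have := adj_parent fP v0; rewrite E adj_edges //.
case/orP=> [/andP[fv0 /eqP gfv]|/andP[_ /eqP //]].
have : fconnect g (f v) v by have := fconnect1 g (f v); rewrite gfv.
rewrite -on_path_edges // -E on_path_edges // => H.
have := fconnect_anti ord0_notin fP H (fconnect1 f v) => fv.
by move: (parent_neq ord0_notin fP vA); rewrite fv eqxx.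
Qed.

(* Breadth-first search gives f with [edges f \subset T]; a further edge of T
   would close a cycle. *)
Lemma tree_edges T : is_tree T -> exists2 f, parent A ord0 f & edges f = T.
Proof.
case/and3P=> /forall_inP sT /forallP cT /acyclicP aT.
pose walk k v := [exists p : k.-tuple 'I_n.+1, path (adj T) ord0 p && (last ord0 p == v)].
have walkP v : exists k, walk k v.
  have /forallP/(_ v)/connectP[p pp ->] := cT ord0.
  by exists (size p); apply/existsP; exists (in_tuple p); rewrite pp eqxx.
pose dist v := ex_minn (walkP v).
have step v : v != ord0 -> exists u, adj T u v && (dist u < dist v)%N.
  rewrite /dist => v0; case: (ex_minnP (walkP v)) => k /existsP[p /andP[pp /eqP pv]] _.
  have := size_tuple p; case/lastP: (val p) pp pv => [|q t] /=.
    by move=> _ E; rewrite E eqxx in v0.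
  rewrite rcons_path last_rcons size_rcons => /andP[pq qt] tv <-.
  exists (last ord0 q); rewrite -tv qt /=; case: ex_minnP => j _; rewrite ltnS; apply.
  by apply/existsP; exists (in_tuple q); rewrite pq eqxx.
pose f := [ffun v =>
  if [pick u | (v != ord0) && (adj T u v && (dist u < dist v)%N)] is Some u then u else ord0].
have f0 : f ord0 = ord0 by rewrite ffunE; case: pickP => // u; rewrite eqxx.
have fstep v : v != ord0 -> adj T (f v) v && (dist (f v) < dist v)%N.
  move=> v0; rewrite ffunE; case: pickP => [u /andP[_ //]|H].
  by have [u Hu] := step v v0; have := H u; rewrite v0 Hu.
have fP : parent A ord0 f.
  apply/parentP; split=> v; rewrite !inE; last by rewrite negbK => /eqP->.
  move=> _; move: {2}(dist v).+1 (ltnSn (dist v)) => k; elim: k v => // k IH v.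
  rewrite ltnS => dv; have [->|v0] := eqVneq v ord0; first exact: connect0.
  apply: connect_trans (fconnect1 f v) (IH _ _).
  by have /andP[_ lt] := fstep v v0; apply: leq_trans lt dv.
exists f => //.
have sub : edges f \subset T.
  apply/subsetP => e /imsetP[v]; rewrite !inE => v0 ->.
  by have /andP[] := fstep v v0; rewrite /adj /= setUC.
have subadj : subrel (adj (edges f)) (adj T) by move=> u v; apply: (subsetP sub).
apply/eqP; rewrite eqEsubset sub; apply/subsetP => e eT.
have /cards2P[u [v [uv Ee]]] := sT e eT; rewrite {}Ee in eT *.
apply/negPn/negP => neT.
have : connect (adj (edges f)) u v.
  have /and3P[_ /forallP/(_ u)/forallP/(_ v) //] := edges_tree fP.
case/connectP=> p pp Ev; rewrite {}Ev in uv eT neT.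
case/shortenP: pp uv eT neT => q pq Uq _ uv eT neT.
have /aT : ucycle (adj T) (u :: q).
  by rewrite /ucycle Uq andbT /= rcons_path (sub_path subadj pq) /adj /= setUC.
(* Acyclicity leaves paths with at most two vertices: a single one contradicts [u != v], and with
   two the edge is already in [edges f]. *)
case: q {Uq} pq uv eT neT => [|t [|s q]] //=; first by rewrite eqxx.
by rewrite andbT => ut _ _; rewrite [_ \in _]ut.
Qed.

End TreesOfParents.

Lemma Q_tree_sum (R : comNzRingType) n (x y z w : R) :
  Q n x y z w = tree_sum x y z [set~ (ord0 : 'I_n.+1)] ord0 w.
Proof.
rewrite /Q; have -> : trees n = @edges n @: [set f | parent [set~ ord0] ord0 f].
  apply/setP => T; rewrite inE; apply/idP/imsetP => [/tree_edges[f fP <-]|[f]].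
    by exists f; rewrite ?inE.
  by rewrite inE => fP ->; apply: edges_tree.
rewrite big_imset; last by move=> f g; rewrite !inE; apply: edges_inj.
apply: eq_big => [f|f]; rewrite inE // => fP.
rewrite /tree_weight lev_edges // deg0_edges // nld_edges // inv_edges //.
by rewrite /phi big_split /= !prodrXr.
Qed.

(** * Words *)

Section Words.

Variables (R : comNzRingType) (x y z : R).
Implicit Types (s l r acc : seq nat) (m : nat).

(** The default value [a] of [head] prevents the last letter from being a descent. *)
Fixpoint word_des s : nat :=
  if s is a :: s' then ((head a s' < a) + word_des s')%N else 0%N.

Fixpoint word_rlm s : nat :=
  if s is a :: s' then (all (gtn a) s' + word_rlm s')%N else 0%N.

(* acc lists the letters already read, the most recent one first. *)
Fixpoint word_runs acc s : R :=
  if s is a :: s' then bracket (find (leq a) acc).+1 x y * word_runs (a :: acc) s'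
  else 1.

(** The word lists the cars by spot. In [word_runs], a letter preceded by a run of exactly [k]
    smaller letters contributes [bracket k.+1], the sum over the preferences which that car can
    have, see [sum_admissible]. *)
Definition word_weight w s : R :=
  word_runs [::] s * z ^+ word_des s * w ^+ word_rlm s.

Lemma word_des_cat l m r : all (gtn m) l -> all (gtn m) r ->
  word_des (l ++ m :: r) = (word_des l + (0 < size r) + word_des r)%N.
Proof.
move=> lm rm; elim: l lm => [|a l IH] /= => [_|/andP[am lm]].
  by case: r rm => //= [|b r /andP[bm _]]; [rewrite ltnn|rewrite bm].
rewrite IH // !addnA; congr (_ + _ + _ + _)%N.
by case: l {IH lm} => //=; rewrite ltnn ltnNge (ltnW am).
Qed.

Lemma word_rlm_cat l m r : all (gtn m) l -> all (gtn m) r ->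
  word_rlm (l ++ m :: r) = (word_rlm r).+1.
Proof.
move=> lm rm; elim: l lm => [|a l IH] /= => [_|/andP[am lm]]; first by rewrite rm.
by rewrite IH // all_cat /= ltnNge (ltnW am) andbF.
Qed.

Lemma word_runs_cat acc l s :
  word_runs acc (l ++ s) = word_runs acc l * word_runs (rev l ++ acc) s.
Proof.
elim: l acc => [|a l IH] acc /=; first by rewrite mul1r.
by rewrite IH mulrA rev_cons cat_rcons.
Qed.

(** A run of letters smaller than a letter of [s] stops at [m] at the latest, so nothing beyond [m]
    matters. *)
Lemma word_runs_barrier acc m acc' s : all (gtn m) s ->
  word_runs (acc ++ m :: acc') s = word_runs acc s.
Proof.
elim: s acc => //= a s IH acc /andP[am sm]; rewrite -cat_cons IH //; congr (_ * _).
rewrite find_cat /= (ltnW am) addn0; case: ifP => // /negbT.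
rewrite has_find -leqNgt => H.
by congr bracket; apply/eqP; rewrite eqSS eqn_leq H find_size.
Qed.

(** The greatest letter [m] is the last car. Its run is all of [l], it starts a descent unless [r]
    is empty, and it hides the right-to-left maxima of [l], whence the argument 1 there. *)
Lemma word_weight_cat w l m r : all (gtn m) l -> all (gtn m) r ->
  word_weight w (l ++ m :: r) =
  bracket (size l).+1 x y * w * z ^+ (0 < size r)%N
   * word_weight 1 l * word_weight w r.
Proof.
move=> lm rm; rewrite /word_weight word_des_cat // word_rlm_cat // expr1n mulr1.
rewrite word_runs_cat /= cats0 -[m :: rev l]/([::] ++ m :: rev l) word_runs_barrier //.
have -> : find (leq m) (rev l) = size l.
  rewrite -(size_rev l); apply: hasNfind; rewrite has_rev -all_predC.
  by apply: sub_all lm => a; rewrite /= -ltnNge.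
rewrite !exprD exprS.
move: (bracket _ _ _) (word_runs _ _) (word_runs _ _) (z ^+ _) (z ^+ _) (z ^+ _) (w ^+ _).
by move=> a b c d e f g; ring.
Qed.

End Words.

(** * Sums over the words in a set of letters *)

Section WordSums.

Lemma mem_words (T : finType) (S : {set T}) (s : seq T) :
  reflect (uniq s /\ s =i S) (s \in permutations (enum S)).
Proof.
rewrite mem_permutations; apply: (iffP idP) => [ps|[Us sS]].
  split=> [|u]; first by rewrite (perm_uniq ps) enum_uniq.
  by rewrite (perm_mem ps) mem_enum.
by apply: uniq_perm => // [|u]; rewrite ?enum_uniq // mem_enum sS.
Qed.

(** A word is determined by the set of letters before [m] and the orders of the letters on both
    sides; conversely the position of [m] recovers all three. *)
Lemma words_split (T : finType) (S : {set T}) m : m \in S ->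
  perm_eq (permutations (enum S))
    [seq p.1 ++ m :: p.2 | B <- enum (powerset (S :\ m)),
       p <- [seq (l, r) | l <- permutations (enum B),
                          r <- permutations (enum (S :\ m :\: B))]].
Proof.
move=> mS; apply: uniq_perm; first exact: permutations_uniq.
- apply: allpairs_uniq_dep => [|B _|]; first exact: enum_uniq.
    by apply: allpairs_uniq; rewrite ?permutations_uniq // => -[? ?] [? ?].
  have memP (u : {_ : {set T} & (seq T * seq T)%type}) :
      u \in [seq @Tagged _ B (fun=> (seq T * seq T)%type) p | B <- enum (powerset (S :\ m)),
        p <- [seq (l, r) | l <- permutations (enum B),
                          r <- permutations (enum (S :\ m :\: B))]] ->
      [/\ (tagged u).1 =i tag u & m \notin (tagged u).1].
    case/allpairsPdep=> B [p [+ + ->]] /=; rewrite mem_enum powersetE => BS.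
    case/allpairsP=> -[l r] /= [/mem_words[_ lB] _ ->] /=; split=> //.
    by rewrite lB; apply/negP => /(subsetP BS); rewrite setD11.
  move=> [B [l r]] [C [l' r']] /memP/= [lB ml] /memP/= [lC ml'] E.
  have El : l = l'.
    have := congr1 (fun s => take (index m s) s) E.
    by rewrite !index_cat (negPf ml) (negPf ml') /= eqxx !addn0 !take_size_cat.
  move: E; rewrite -El => /eqP; rewrite eqseq_cat // eqxx /= eqseq_cons eqxx /= => /eqP->.
  by have -> : B = C by apply/setP => u; rewrite -[u \in B]lB -[u \in C]lC El.
move=> s; apply/mem_words/allpairsPdep => [[Us sS]|].
  have ms : m \in s by rewrite sS.
  case/splitPr: ms Us sS => l r; rewrite cat_uniq /= negb_or.
  case/and3P=> Ul /andP[ml lr] /andP[mr Ur] sS.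
  exists [set u in l], (l, r); split=> //.
    rewrite mem_enum powersetE; apply/subsetP => u; rewrite !inE => ul.
    by rewrite -sS mem_cat ul andbT; apply: contraNneq ml => <-.
  apply/allpairsP; exists (l, r); split=> //; apply/mem_words; split=> // u.
    by rewrite inE.
  rewrite !inE -sS mem_cat inE.
  have [ul|ul] /= := boolP (u \in l).
    by apply/negP => ur; case/hasP: lr; exists u.
  by have [->|//] := eqVneq u m; rewrite (negPf mr).
case=> B [p [+ + ->]]; rewrite mem_enum powersetE => BS.
case/allpairsP=> -[l r] /= [/mem_words[Ul lB] /mem_words[Ur rB] ->] /=; split.
  rewrite cat_uniq Ul /= Ur rB !inE eqxx andbF lB negb_or !andbT.
  apply/andP; split; first by apply/negP => /(subsetP BS); rewrite setD11.
  by apply/hasPn => u; rewrite rB lB inE => /andP[].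
move=> u; rewrite mem_cat inE rB lB !inE.
have [->|um] /= := eqVneq u m; first by rewrite mS orbT.
by case: (boolP (u \in B)) => //= /(subsetP BS); rewrite !inE => /andP[_ ->].
Qed.

Variables (R : comNzRingType) (x y z : R).

Definition word_sum N (S : {set 'I_N}) w : R :=
  \sum_(s <- permutations (enum S)) word_weight x y z w (map val s).

Lemma word_sum0 N w : word_sum (set0 : {set 'I_N}) w = 1.
Proof.
by rewrite /word_sum enum_set0 big_seq1 /word_weight /= !expr0 !mulr1.
Qed.

Lemma word_sum_split N (S : {set 'I_N}) m w : m \in S ->
  (forall u, u \in S -> (u <= m)%N) ->
  word_sum S w =
  \sum_(B in powerset (S :\ m))
    bracket #|B|.+1 x y * w * z ^+ (#|B| < #|S :\ m|)%N
     * word_sum B 1 * word_sum (S :\ m :\: B) w.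
Proof.
move=> mS mmax; rewrite /word_sum (perm_big _ (words_split mS)) big_allpairs_dep /=.
rewrite big_enum; apply: eq_bigr => B; rewrite powersetE => BS.
rewrite big_allpairs -!mulrA mulr_suml !mulr_sumr; rewrite [LHS]big_seq [RHS]big_seq.
apply: eq_bigr => l /mem_words[Ul lB]; rewrite !mulr_sumr [LHS]big_seq [RHS]big_seq.
apply: eq_bigr => r /mem_words[Ur rB] /=; rewrite map_cat /=.
have small s (C : {set 'I_N}) : s =i C -> C \subset S :\ m ->
    all (gtn m) (map val s).
  move=> sC CS; rewrite all_map; apply/allP => u; rewrite sC => /(subsetP CS).
  by rewrite !inE => /andP[um /mmax]; rewrite /= ltn_neqAle um.
rewrite word_weight_cat ?(small _ _ lB) ?(small _ _ rB) ?subsetDl // !size_map.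
rewrite -(card_uniqP Ul) -(card_uniqP Ur) (eq_card lB) (eq_card rB).
by rewrite cardsD (setIidPr BS) subn_gt0 !mulrA.
Qed.

Lemma word_sum_rec (q : nat -> R -> R) N (S : {set 'I_N}) w :
  (0 < #|S|)%N -> q 0%N w = 1 ->
  (forall (B : {set 'I_N}) u, (#|B| < #|S|)%N -> word_sum B u = q #|B| u) ->
  word_sum S w = rec_rhs x y z q #|S| w.
Proof.
case/card_gt0P=> m0 m0S q0 IH.
have [m /= mS mmax] := arg_maxnP (fun v : 'I_N => val v) m0S.
have {}mS : m \in S := mS.
have cS : #|S| = #|S :\ m|.+1 by rewrite (cardsD1 m) mS.
rewrite (word_sum_split _ mS mmax) cS rec_rhsE //.
apply: eq_bigr => B; rewrite powersetE => BS.
rewrite !IH ?cS ?ltnS ?subset_leq_card ?subsetDl //.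
by rewrite (cardsD (S :\ m)) (setIidPr BS).
Qed.

(** The same strong induction as in [tree_sum_card]. *)
Lemma word_sum_card N (S : {set 'I_N}) w :
  word_sum S w = word_sum [set: 'I_#|S|] w.
Proof.
pose q n u := word_sum [set: 'I_n] u.
have q0 u : q 0%N u = 1.
  by rewrite /q [setT](_ : _ = set0) ?word_sum0 //; apply/setP => -[].
move: {2}#|S|.+1 (ltnSn #|S|) => k.
elim: k N S w => [//|k IH] N S w; rewrite ltnS => cS.
have [S0|S_gt0] := posnP #|S|.
  by rewrite -[RHS]/(q _ _) S0 q0 (cards0_eq S0) word_sum0.
have step M (B : {set 'I_M}) : #|B| = #|S| ->
    word_sum B w = rec_rhs x y z q #|S| w.
  move=> cB; rewrite -cB; apply: word_sum_rec; rewrite ?cB //.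
  by move=> C u cC; rewrite IH // (leq_trans cC).
by rewrite !step // cardsT card_ord.
Qed.

End WordSums.

(** * Parking functions with a given outcome *)

Section WordStatistics.

Variables (R : comNzRingType) (x y : R).

Lemma word_desE s : word_des s =
  (\sum_(0 <= i < size s) ((i.+1 < size s) && (nth 0 s i.+1 < nth 0 s i)))%N.
Proof.
elim: s => [|a s IH] /=; first by rewrite big_nil.
rewrite big_nat_recl //= IH; congr (_ + _)%N.
by case: s {IH} => //=; rewrite ltnn.
Qed.

Lemma word_rlmE s : word_rlm s =
  (\sum_(0 <= i < size s) all (gtn (nth 0 s i)) (drop i.+1 s))%N.
Proof.
elim: s => [|a s IH] /=; first by rewrite big_nil.
by rewrite big_nat_recl //= IH drop0.
Qed.

Lemma word_runsE acc s : word_runs x y acc s =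
  \prod_(0 <= i < size s)
    bracket (find (leq (nth 0%N s i)) (rev (take i s) ++ acc)).+1 x y.
Proof.
elim: s acc => [|a s IH] acc /=; first by rewrite big_nil.
rewrite big_nat_recl //= IH; congr (_ * _).
by apply: eq_bigr => i _; rewrite rev_cons cat_rcons.
Qed.

End WordStatistics.

(** * Permutations as words *)

Section PermWords.

Variable n : nat.
Implicit Types (c : 'S_n) (i j : 'I_n).

Definition perm_word c : seq nat := map val (codom c).

Lemma size_perm_word c : size (perm_word c) = n.
Proof. by rewrite size_map size_codom card_ord. Qed.

Lemma nth_perm_word c i : nth 0%N (perm_word c) i = c i.
Proof.
rewrite (nth_map i) ?size_codom ?card_ord // (nth_map i) -?enumT ?size_enum_ord //.
by rewrite nth_ord_enum.
Qed.

Lemma word_des_perm c : word_des (perm_word c) = perm_des c.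
Proof.
rewrite word_desE size_perm_word big_mkord /perm_des -sum1_card [RHS]big_mkcond /=.
apply: eq_bigr => i _; rewrite inE.
set b := [exists j, _]; suff -> :
  b = ((i.+1 < n) && (nth 0 (perm_word c) i.+1 < nth 0 (perm_word c) i))%N
  by case: (_ && _).
apply/existsP/andP => [[j /andP[/eqP ji lt]]|[lt]].
  by rewrite -ji ltn_ord !nth_perm_word.
rewrite -[i.+1]/(val (Ordinal lt)) !nth_perm_word => H.
by exists (Ordinal lt); rewrite eqxx.
Qed.

Lemma word_rlm_perm c : word_rlm (perm_word c) = perm_rlm c.
Proof.
rewrite word_rlmE size_perm_word big_mkord /perm_rlm -sum1_card [RHS]big_mkcond /=.
apply: eq_bigr => i _; rewrite inE.
set b := [forall j, _]; suff -> :
  b = all (gtn (nth 0 (perm_word c) i)) (drop i.+1 (perm_word c)) by case: (all _ _).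
apply/forallP/(all_nthP 0%N) => [H k|H j].
  rewrite size_drop size_perm_word ltn_subRL nth_drop => lt.
  have := H (Ordinal lt); rewrite -[(i.+1 + k)%N]/(val (Ordinal lt)) !nth_perm_word /=.
  by rewrite leq_addr.
apply/implyP => ij; have := H (j - i.+1)%N; rewrite nth_drop subnKC // !nth_perm_word.
by apply; rewrite size_drop size_perm_word ltn_sub2r // (leq_ltn_trans ij).
Qed.

Lemma perm_words : perm_eq (permutations (enum [set: 'I_n]))
  [seq codom c | c : 'S_n].
Proof.
apply: uniq_perm; first exact: permutations_uniq.
  rewrite map_inj_uniq ?enum_uniq // => c d E; apply/permP => i; apply: val_inj.
  have := nth_perm_word c i.
  by rewrite /perm_word E -/(perm_word d) nth_perm_word => H; apply: esym H.
move=> s; apply/mem_words/mapP => [[Us sT]|[c _ ->]]; last first.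
  split=> [|i]; first by rewrite map_inj_uniq -?enumT ?enum_uniq //; apply: perm_inj.
  by rewrite inE -[i](permKV c) codom_f.
have szs : size s = n.
  by rewrite -(card_uniqP Us) (eq_card sT) cardsT card_ord.
(* The varying default [i] allows the permutation to be defined before [n] is known to be
   positive. *)
have f_inj : injective (fun i => nth i s i).
  move=> i j; rewrite (set_nth_default i j) ?szs //.
  by move/eqP; rewrite nth_uniq ?szs // => /eqP/val_inj.
exists (perm f_inj); first by rewrite mem_enum.
case: n s Us sT szs f_inj => [|k] s _ _ szs f_inj.
  apply: etrans (size0nil szs) _.
  by apply/esym/size0nil; rewrite size_codom card_ord.
apply: (@eq_from_nth _ ord0); first by rewrite size_codom card_ord.
move=> i; rewrite szs => lt.
rewrite -[i]/(val (Ordinal lt)) (nth_map ord0) -?enumT ?size_enum_ord //.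
by rewrite nth_ord_enum permE; apply: set_nth_default; rewrite szs.
Qed.

Lemma word_sum_perm (R : comNzRingType) (x y z w : R) :
  word_sum x y z [set: 'I_n] w =
  \sum_(c : 'S_n) word_runs x y [::] (perm_word c) * z ^+ perm_des c * w ^+ perm_rlm c.
Proof.
rewrite /word_sum (perm_big _ perm_words) /= big_map big_enum /=.
apply: eq_bigr => c _; rewrite /word_weight -[map _ _]/(perm_word c).
by rewrite word_des_perm word_rlm_perm.
Qed.

End PermWords.

Section ParkingOutcome.

Variable n : nat.
Implicit Types (pi : n.+1.-tuple 'I_n.+1) (c s : 'S_n.+1) (i j a : 'I_n.+1).

Lemma parkP (occ : {set 'I_n.+1}) (t b : seq 'I_n.+1) : size b = size t ->
  park occ t = map Some b <->
  (forall k, (k < size t)%N ->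
     first_free (occ :|: [set j in take k b]) (nth ord0 t k) = Some (nth ord0 b k)).
Proof.
elim: t b occ => [|a t IH] [|j b] occ //= [sz].
have set_nil : [set i in [::]] = set0 :> {set 'I_n.+1}.
  by apply/setP => i; rewrite !inE.
have set_cons (k : nat) : occ :|: [set i in take k.+1 (j :: b)]
    = (j |: occ) :|: [set i in take k b].
  by apply/setP => i; rewrite !inE orbCA orbA.
split=> [|H].
  case E: first_free => [j'|] //= [ej pb]; subst j' => -[|k] /=.
    by rewrite set_nil setU0.
  by rewrite ltnS set_cons => lt; apply: (IH b (j |: occ) sz).1.
have /= := H 0%N isT; rewrite set_nil setU0 => ->; congr (_ :: _); apply/(IH b (j |: occ) sz) => k lt.
by rewrite -set_cons; apply: (H k.+1).
Qed.

(** The car [c i], which parks at spot [i], may prefer [a]: all spots from [a] up to [i - 1] must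
    have been taken by earlier cars. *)
Definition admissible (c : 'S_n.+1) i a : bool :=
  (a <= i)%N && [forall k : 'I_n.+1, (a <= k < i)%N ==> (c k < c i)%N].

(** When car [i] arrives, the occupied spots are those with [c j < i], so its first free spot is the
    prescribed one exactly if its preference is admissible. The cars thus choose independently of
    each other. *)
Lemma outcomeP pi c :
  (pi \in PF n.+1) && ((oc pi)^-1%g == c)
  = [forall i, admissible c (c^-1%g i) (tnth pi i)].
Proof.
set s := c^-1%g; pose b := codom s.
have szb : size b = size pi by rewrite size_codom size_tuple card_ord.
have nthb i : nth ord0 b i = s i.
  by rewrite (nth_map i) -?enumT ?size_enum_ord // nth_ord_enum.
have nthpi i : nth ord0 pi i = tnth pi i by rewrite (tnth_nth ord0).
have takeb i : set0 :|: [set j in take i b] = [set j | (c j < i)%N].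
  rewrite set0U; apply/setP => j; rewrite !inE in_take.
    by rewrite -{1}[j](permK c) -/s index_map ?index_enum_ord //; apply: perm_inj.
  by rewrite -[j](permK c) codom_f.
have parkE : (pi \in PF n.+1) && ((oc pi)^-1%g == c) <-> park set0 pi = map Some b.
  rewrite inE; split=> [/andP[pf /eqP ocpi]|E].
    apply: (@eq_from_nth _ None) => [|k]; first by rewrite size_park size_map szb.
    rewrite size_park size_tuple => lt.
    rewrite (nth_map ord0) ?szb ?size_tuple //.
    by rewrite -[k]/(val (Ordinal lt)) nthb /s -ocpi invgK -ocE.
  have pf : parking_function pi by rewrite /parking_function E; elim: (b).
  rewrite pf /=; apply/eqP; rewrite -[c]invgK -/s; congr (_^-1)%g.
  apply/permP => i; have := ocE i pf; rewrite /spot E (nth_map ord0) ?szb ?size_tuple //.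
  by rewrite nthb => -[].
apply/idP/forallP => [/parkE/(parkP _ szb) H i|H].
  have := H i; rewrite size_tuple ltn_ord nthpi nthb takeb => /(_ isT)/eqP/first_freeP.
  case=> le _ min; rewrite /admissible le; apply/forallP => k.
  apply/implyP => /andP[ak ks]; rewrite permKV; apply: contraLR ks => ck; rewrite -leqNgt; apply: min => //.
  by rewrite inE.
apply/parkE/(parkP _ szb) => k; rewrite size_tuple => lt.
rewrite -[k]/(val (Ordinal lt)) nthpi nthb takeb; move: (Ordinal lt) => i.
have /andP[le /forallP Hk] := H i.
apply/eqP/first_freeP; split=> // [|k' ak]; rewrite inE ?permKV ?ltnn //.
by rewrite -leqNgt => ik; rewrite leqNgt; apply: contraL ik => ks;
  have := Hk k'; rewrite ak ks permKV /= -ltnNge.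
Qed.

Variables (R : comNzRingType) (x y z w : R).

(** The admissible preferences are [i], [i - 1], ..., [i - f], where [f] is the length of the run of
    smaller values just before position [i]; the displacements are 0, ..., [f]. *)
Lemma sum_admissible c i :
  \sum_(a | admissible c i a) phi x y (i - a) =
  bracket (find (leq (c i)) (rev (take i (perm_word c)))).+1 x y.
Proof.
set t := rev _; set f := find _ t.
have szt : size t = i by rewrite size_rev size_takel // size_perm_word ltnW.
have ft : (f <= i)%N by rewrite -szt find_size.
have nth_t (k : 'I_n.+1) : (k < i)%N -> nth 0%N t (i - k.+1) = c k.
  move=> ki; rewrite nth_rev size_takel ?size_perm_word ?(ltnW (ltn_ord i)) //.
    by rewrite -subSn // subSS subKn ?(ltnW ki) // nth_take // nth_perm_word.
  by rewrite ltn_subrL (leq_ltn_trans _ ki).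
have admE a : admissible c i a = (a <= i)%N && (i - a <= f)%N.
  rewrite /admissible; case: leqP => //= ai.
  apply/forallP/idP => [H|le k].
    (* A larger displacement would include position [i - f - 1], where the run is broken by a value
       that is not smaller than [c i]. *)
    rewrite leqNgt; apply/negP => lt; have fi : (f < i)%N := leq_trans lt (leq_subr _ _).
    have kn : (i - f.+1 < n.+1)%N := leq_ltn_trans (leq_subr _ _) (ltn_ord i).
    have /implyP := H (Ordinal kn); rewrite /= ltn_subrL (leq_ltn_trans _ fi) //.
    have af : (a <= i - f.+1)%N by rewrite -(subKn ai) leq_sub2l.
    rewrite af => /(_ isT).
    rewrite -nth_t /= ?ltn_subrL ?(leq_ltn_trans _ fi) //.
    rewrite -subSn // subSS subKn ?(ltnW fi) //.
    have /(nth_find 0%N) : has (leq (c i)) t by rewrite has_find szt.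
    by rewrite -/f ltnNge => ->.
  apply/implyP => /andP[ak ki]; rewrite -nth_t // ltnNge.
  apply/negbT/before_find/(leq_trans _ le).
  by rewrite ltn_sub2l ?ltnS // (leq_ltn_trans ak).
rewrite bracketE // (eq_bigl _ _ admE).
have lt_n (d : nat) : (i - d < n.+1)%N := leq_ltn_trans (leq_subr _ _) (ltn_ord i).
rewrite (reindex_onto (fun d : 'I_f.+1 => inord (i - d)%N : 'I_n.+1)
   (fun a : 'I_n.+1 => inord (i - a)%N)) /=; last first.
  by move=> a /andP[ai af]; apply: val_inj; rewrite /= !inordK ?subKn.
apply: eq_big => [d|d _].
  have di : (d <= i)%N by apply: leq_trans ft; rewrite -ltnS.
  by rewrite inordK // leq_subr subKn // inord_val eqxx -ltnS ltn_ord.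
by rewrite inordK // subKn // (leq_trans _ ft) // -ltnS.
Qed.

(** Group the parking functions by outcome. The number of descents and of right-to-left maxima is
    then constant, and since the preferences are independent, the sum of products over the cars is a
    product of sums. *)
Lemma P_succ_word_sum : P n.+1 x y z w = word_sum x y z [set: 'I_n.+1] w.
Proof.
rewrite word_sum_perm /P (partition_big (fun pi => (oc pi)^-1%g) xpredT) //=.
apply: eq_bigr => c _.
rewrite -mulrA.
pose F i a := phi x y (c^-1%g i - a)%N.
transitivity (\sum_(f in family (fun i => admissible c (c^-1%g i))) \prod_i F i (f i)
   * (z ^+ perm_des c * w ^+ perm_rlm c)).
  rewrite (reindex (fun f : {ffun 'I_n.+1 -> 'I_n.+1} =>
    [tuple f i | i < n.+1])) /=; last first.
    exists (fun pi => [ffun i => tnth pi i]) => [f _|pi _].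
      by apply/ffunP => i; rewrite ffunE tnth_mktuple.
    by apply: eq_from_tnth => i; rewrite tnth_mktuple ffunE.
  apply: eq_big => [f|f]; rewrite outcomeP.
    by apply: eq_forallb => i; rewrite tnth_mktuple.
  move=> adm; have := adm; rewrite -outcomeP => /andP[_ /eqP E].
  have oi i : (oc [tuple f i | i < n.+1]) i = c^-1%g i by rewrite -E invgK.
  rewrite /des /rlm E -mulrA; congr (_ * _).
  rewrite /F /phi big_split /= !prodrXr; congr (_ ^+ _ * _ ^+ _); last first.
    by apply: eq_bigr => i _; rewrite oi tnth_mktuple.
  rewrite /unl -sum1_card big_mkcond /=; apply: eq_bigr => i _.
  rewrite inE oi tnth_mktuple subn_gt0.
  have /forallP/(_ i)/andP[le _] := adm; rewrite tnth_mktuple in le.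
  by rewrite ltn_neqAle le andbT -val_eqE eq_sym; case: (_ != _).
rewrite -mulr_suml -(bigA_distr_big_dep _ F); congr (_ * _).
(* One product runs over the cars and the other over the spots; car [i] stands at spot [c^-1 i]. *)
rewrite word_runsE size_perm_word big_mkord [RHS](reindex_inj (@perm_inj _ c^-1%g)).
apply: eq_bigr => i _ /=.
by rewrite cats0 nth_perm_word -sum_admissible.
Qed.

End ParkingOutcome.

Lemma P_word_sum (R : comNzRingType) n (x y z w : R) :
  P n x y z w = word_sum x y z [set: 'I_n] w.
Proof.
case: n => [|n]; last exact: P_succ_word_sum.
by rewrite P0 [setT](_ : _ = set0) ?word_sum0 //; apply/setP => -[].
Qed.

(** * The two recurrences *)

Lemma P_rec (R : comNzRingType) (x y z w : R) n :
  P n.+1 x y z w = rec_rhs x y z (fun k => P k x y z) n.+1 w.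
Proof.
rewrite P_word_sum -[in RHS](card_ord n.+1) -cardsT.
apply: word_sum_rec => [||B u _]; rewrite ?cardsT ?card_ord ?P0 //.
by rewrite word_sum_card P_word_sum.
Qed.

Lemma Q_rec (R : comNzRingType) (x y z w : R) n :
  Q n.+1 x y z w = rec_rhs x y z (fun k => Q k x y z) n.+1 w.
Proof.
have cA : #|[set~ (ord0 : 'I_n.+2)]| = n.+1 by rewrite cardsC1 card_ord.
rewrite Q_tree_sum -[in RHS]cA.
apply: tree_sum_rec => [|||B s u sB _]; rewrite ?cA ?Q0 ?inE ?eqxx //.
by rewrite tree_sum_card // Q_tree_sum.
Qed.

Theorem theorem2p1 (R : comNzRingType) (x y z w : R) (n : nat) (hn : (1 <= n)%N) :
  (P n x y z w =
     bracket n x y * w * P (n - 1) x y z 1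
     + \sum_(0 <= i < n - 1)
         'C(n - 1, i)%:R * bracket i.+1 x y * z * w
         * P i x y z 1 * P (n - i - 1) x y z w)
  /\
  (Q n x y z w =
     bracket n x y * w * Q (n - 1) x y z 1
     + \sum_(0 <= i < n - 1)
         'C(n - 1, i)%:R * bracket i.+1 x y * z * w
         * Q i x y z 1 * Q (n - i - 1) x y z w).
Proof. by case: n hn => // n _; split; [apply: P_rec | apply: Q_rec]. Qed.
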